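(* Let $\epsilon>0$ and let the fixed intensity $\tilde\mu_s$ satisfy $$\tilde\mu_s(1+\epsilon)\le 1-\frac{p_0}{\left(\frac{\alpha}{1+\epsilon}+p_0\right)\left(1-h\left(\frac{s\frac{\alpha}{1+\epsilon}+\frac{p_0}{2}}{\frac{\alpha}{1+\epsilon}+p_0}\right)\right)}.$$ With $R_e$, $\tilde R_e$ and the worst-case rates $R_e(\tilde\mu_s,\tilde\mu_d,\epsilon)$, $\tilde R_e(\tilde\mu_s,\tilde\mu_d,\epsilon)$ as defined in the context, and with the suprema taken over decoy intensities $0<\tilde\mu_d<\tilde\mu_s$ that are distinguishable from $\tilde\mu_s$, i.e. $(1+\epsilon)\tilde\mu_d<(1-\epsilon)\tilde\mu_s$, $$R_e(\tilde\mu_s,\epsilon):=\sup_{\tilde\mu_d}R_e(\tilde\mu_s,\tilde\mu_d,\epsilon)=\lim_{\tilde\mu_d\to0}R_e(\tilde\mu_s,\tilde\mu_d,\epsilon)=\lim_{\tilde\mu_d\to0}R_e\big((1-\epsilon)\tilde\mu_s,(1+\epsilon)\tilde\mu_d,\tilde\mu_s,\tilde\mu_d\big)=L$$ and $$\tilde R_e(\tilde\mu_s,\epsilon):=\sup_{\tilde\mu_d}\tilde R_e(\tilde\mu_s,\tilde\mu_d,\epsilon)=\lim_{\tilde\mu_d\to0}\tilde R_e(\tilde\mu_s,\tilde\mu_d,\epsilon)=\lim_{\tilde\mu_d\to0}\tilde R_e\big((1-\epsilon)\tilde\mu_s,(1+\epsilon)\tilde\mu_d,\tilde\mu_s,\tilde\mu_d\big)=L,$$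 where $$L=(1-\epsilon)\tilde\mu_s e^{-(1-\epsilon)\tilde\mu_s}\left(\frac{\alpha}{1+\epsilon}+p_0\right)\left(1-h\left(\frac{s\frac{\alpha}{1+\epsilon}+\frac{p_0}{2}}{\frac{\alpha}{1+\epsilon}+p_0}\right)\right)+e^{-(1-\epsilon)\tilde\mu_s}p_0-p_{s,+}\,\eta\,h(e_{s,+}).$$
   Context: $h(x)=-x\log_2 x-(1-x)\log_2(1-x)$ is the binary entropy; $[x]_+=\max(x,0)$. Parameters: $\alpha$ (total transmission), $s$ (error due to the imperfection of the optical system), $p_0$ (detection rate of the vacuum pulse), $\eta$ (efficiency of error correction), $\epsilon$ (error ratio of the intensities). Model: for $i\in\{s,d\}$ (signal, decoy), $p_{i,+}=p_{i,\times}=1-e^{-\alpha\tilde\mu_i}+p_0$ and $e_{i,+}p_{i,+}=e_{i,\times}p_{i,\times}=s(1-e^{-\alpha\tilde\mu_i})+\frac{p_0}{2}$. For $0<\mu_1<\mu_2$ define $$f_a(p_1,p_2,\mu_1,\mu_2)=\left[\frac{\mu_2^2e^{\mu_1}(p_1-p_0e^{-\mu_1})-\mu_1^2e^{\mu_2}(p_2-p_0e^{-\mu_2})}{\mu_1\mu_2(\mu_2-\mu_1)}\right]_+,$$ $$f_b(s_1,\mu_1)=\left[\frac{s_1e^{\mu_1}-p_0/2}{\mu_1}\right]_+,$$ $$f_c(p_1,p_2,\mu_1,\mu_2)=\left[\frac{\mu_2^2e^{\mu_1}(p_1-p_0e^{-\mu_1}/2)-\mu_1^2e^{\mu_2}(p_2-p_0e^{-\mu_2}/2)}{\mu_1\mu_2(\mu_2-\mu_1)}\right]_+.$$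 For $0<\mu_d<\mu_s$ (the only case needed here) put $\hat a=f_a(p_{d,\times},p_{s,\times},\mu_d,\mu_s)$, $\hat b=f_b(e_{d,\times}p_{d,\times},\mu_d)$, $\hat c=f_c((1-e_{d,\times})p_{d,\times},(1-e_{s,\times})p_{s,\times},\mu_d,\mu_s)$, and $$R_e(\mu_s,\mu_d,\tilde\mu_s,\tilde\mu_d)=\mu_se^{-\mu_s}(\hat c+\hat b)\Big(1-h\Big(\tfrac{\hat b}{\hat c+\hat b}\Big)\Big)+e^{-\mu_s}p_0-p_{s,+}\,\eta\,h(e_{s,+}),$$ $$\tilde R_e(\mu_s,\mu_d,\tilde\mu_s,\tilde\mu_d)=\mu_se^{-\mu_s}\,\hat a\Big(1-h\Big(\tfrac{\hat b}{\hat a}\Big)\Big)+e^{-\mu_s}p_0-p_{s,+}\,\eta\,h(e_{s,+}).$$ Worst-case rates: $$R_e(\tilde\mu_s,\tilde\mu_d,\epsilon)=\min R_e(\mu_s,\mu_d,\tilde\mu_s,\tilde\mu_d),\qquad \tilde R_e(\tilde\mu_s,\tilde\mu_d,\epsilon)=\min\tilde R_e(\mu_s,\mu_d,\tilde\mu_s,\tilde\mu_d),$$ both minima over $\mu_i\in[(1-\epsilon)\tilde\mu_i,(1+\epsilon)\tilde\mu_i]$, $i=s,d$.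
   Formalization: Proved for 0<α≤1, 0≤s<1/2, p_0≥0, ε<1; limits as stated, but the supremum is over decoys whose estimated phase error ratio is ≤1/2 for all true intensities, or over all decoys with h of that ratio set to 1 above 1/2, since as written the supremum can exceed L. *)

(* Defs.v *)
From HB Require Import structures.
From mathcomp Require Import all_boot all_order all_algebra.
From mathcomp Require Import all_classical all_reals all_analysis.

Set Implicit Arguments.
Unset Strict Implicit.
Unset Printing Implicit Defensive.

Import Order.TTheory GRing.Theory Num.Theory.
Import numFieldNormedType.Exports.

Local Open Scope classical_set_scope.
Local Open Scope ring_scope.

(* [ln 0 = 0], so [h 0 = h 1 = 0]. *)
Definition h (R : realType) (x : R) : R :=
  - x * (ln x / ln 2) - (1 - x) * (ln (1 - x) / ln 2).

(* The usual convention of key-rate formulas for an *estimated* phase error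
   ratio: above 1/2 the estimate is useless, and its entropy counts as 1. *)
Definition h_phase (R : realType) (x : R) : R := h (Num.min x 2^-1).

Definition pos_part (R : realType) (x : R) : R := Num.max x 0.

(* The model gives the bases + and x the same rates, hence one function for
   both; [mt] is the nominal intensity. *)
Definition det_rate (R : realType) (alpha p0 mt : R) : R :=
  1 - expR (- (alpha * mt)) + p0.

Definition err_rate (R : realType) (alpha s p0 mt : R) : R :=
  (s * (1 - expR (- (alpha * mt))) + p0 / 2) / det_rate alpha p0 mt.

Definition f_a (R : realType) (p0 p1 p2 m1 m2 : R) : R :=
  pos_part ((m2 ^+ 2 * expR m1 * (p1 - p0 * expR (- m1))
             - m1 ^+ 2 * expR m2 * (p2 - p0 * expR (- m2)))
            / (m1 * m2 * (m2 - m1))).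

Definition f_b (R : realType) (p0 s1 m1 : R) : R :=
  pos_part ((s1 * expR m1 - p0 / 2) / m1).

Definition f_c (R : realType) (p0 p1 p2 m1 m2 : R) : R :=
  pos_part ((m2 ^+ 2 * expR m1 * (p1 - p0 * expR (- m1) / 2)
             - m1 ^+ 2 * expR m2 * (p2 - p0 * expR (- m2) / 2))
            / (m1 * m2 * (m2 - m1))).

(* Arguments: true signal and decoy intensities, then the nominal ones. *)
Definition a_hat (R : realType) (alpha p0 ms md mts mtd : R) : R :=
  f_a p0 (det_rate alpha p0 mtd) (det_rate alpha p0 mts) md ms.

Definition b_hat (R : realType) (alpha s p0 md mtd : R) : R :=
  f_b p0 (err_rate alpha s p0 mtd * det_rate alpha p0 mtd) md.

Definition c_hat (R : realType) (alpha s p0 ms md mts mtd : R) : R :=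
  f_c p0 ((1 - err_rate alpha s p0 mtd) * det_rate alpha p0 mtd)
         ((1 - err_rate alpha s p0 mts) * det_rate alpha p0 mts) md ms.

(* [H] is the entropy applied to the estimated phase error ratio: [h] or
   [h_phase]. *)
Definition key_rate (R : realType) (H : R -> R)
    (alpha s p0 eta ms md mts mtd : R) : R :=
  let b := b_hat alpha s p0 md mtd in
  let c := c_hat alpha s p0 ms md mts mtd in
  ms * expR (- ms) * (c + b) * (1 - H (b / (c + b))) + expR (- ms) * p0
  - det_rate alpha p0 mts * eta * h (err_rate alpha s p0 mts).

Definition tkey_rate (R : realType) (H : R -> R)
    (alpha s p0 eta ms md mts mtd : R) : R :=
  let a := a_hat alpha p0 ms md mts mtd in
  let b := b_hat alpha s p0 md mtd in
  ms * expR (- ms) * a * (1 - H (b / a)) + expR (- ms) * p0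
  - det_rate alpha p0 mts * eta * h (err_rate alpha s p0 mts).

Definition true_intensities (R : realType) (eps mt : R) : set R :=
  `[(1 - eps) * mt, (1 + eps) * mt].

Definition rate_values (R : realType) (rate : R -> R -> R -> R -> R)
    (eps mts mtd : R) : set R :=
  [set rate m.1 m.2 mts mtd
     | m in true_intensities eps mts `*` true_intensities eps mtd].

Definition worst_rate (R : realType) (rate : R -> R -> R -> R -> R)
    (eps mts mtd : R) : R :=
  inf (rate_values rate eps mts mtd).

Definition decoys (R : realType) (eps mts : R) : set R :=
  [set mtd | [/\ 0 < mtd, mtd < mts & (1 + eps) * mtd < (1 - eps) * mts]].

(* The decoy intensities for which the estimated phase error ratio, b/(c+b)
   for [key_rate] and b/a for [tkey_rate], is at most 1/2 for all possible
   true intensities. Beyond 1/2 the factor 1 - h grows again with the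
   estimated error, and b/a may even leave [0, 1], so that the formulas with
   [h] no longer bound a key rate. *)
Definition decoys_key_rate (R : realType) (alpha s p0 eps mts : R) : set R :=
  [set mtd | decoys eps mts mtd /\
     forall ms md, true_intensities eps mts ms -> true_intensities eps mtd md ->
       b_hat alpha s p0 md mtd <=
         (c_hat alpha s p0 ms md mts mtd + b_hat alpha s p0 md mtd) / 2].

Definition decoys_tkey_rate (R : realType) (alpha s p0 eps mts : R) : set R :=
  [set mtd | decoys eps mts mtd /\
     forall ms md, true_intensities eps mts ms -> true_intensities eps mtd md ->
       b_hat alpha s p0 md mtd <= a_hat alpha p0 ms md mts mtd / 2].

(* The first clause says that the infimum [worst_rate] is a minimum. The
   supremum is taken in \bar R, where it is never a default value. *)
Definition sup_is_limit_at0 (R : realType) (D : set R)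
    (rate : R -> R -> R -> R -> R) (eps mts L : R) : Prop :=
  [/\ forall mtd, D mtd ->
        rate_values rate eps mts mtd (worst_rate rate eps mts mtd) /\
        lbound (rate_values rate eps mts mtd) (worst_rate rate eps mts mtd),
      ereal_sup [set (worst_rate rate eps mts mtd)%:E | mtd in D] = L%:E,
      worst_rate rate eps mts mtd @[mtd --> 0^'+] --> L &
      rate ((1 - eps) * mts) ((1 + eps) * mtd) mts mtd @[mtd --> 0^'+] --> L].

(* Limits, as the decoy intensity vanishes, of the smallest possible
   single-photon detection rate and of its phase error ratio. *)
Definition photon_rate0 (R : realType) (alpha p0 eps : R) : R :=
  alpha / (1 + eps) + p0.

Definition phase_err0 (R : realType) (alpha s p0 eps : R) : R :=
  (s * (alpha / (1 + eps)) + p0 / 2) / photon_rate0 alpha p0 eps.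

Definition limit_rate (R : realType) (alpha s p0 eta eps mts : R) : R :=
  (1 - eps) * mts * expR (- ((1 - eps) * mts)) * photon_rate0 alpha p0 eps
    * (1 - h (phase_err0 alpha s p0 eps))
  + expR (- ((1 - eps) * mts)) * p0
  - det_rate alpha p0 mts * eta * h (err_rate alpha s p0 mts).

(* Main.v *)
(** Write [a] for the estimated single-photon detection rate, [b] for its
    erroneous part and [phi a b = a * (1 - h_phase (b / a))]. By Gibbs' inequality,
    [phi a b] is the maximum over [0 < q <= 1/2] of
    [(a - b) * (1 + log2 (1 - q)) + b * (1 + log2 q)], whose coefficients are
    respectively nonnegative and nonpositive: [phi] increases with [a - b] and
    decreases with [b].

    At the true intensities [(1 - eps) * mts] and [(1 + eps) * mtd], expanding
    the exponentials in power series shows that [a - b] is at most and [b] at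
    least its limit for [mtd --> 0], so that every worst-case rate is at most
    [L]. Conversely, evaluating the linear function at the [q] of the limit
    bounds the rate at all possible true intensities from below by
    [L - K * mtd]: the limit of the linear function is increasing in
    [alpha * mtd / md], hence smallest at [md = (1 + eps) * mtd], and the
    hypothesis on [mts] makes [ms |-> (ms * phi + p0) * expR (- ms)]
    nondecreasing, hence smallest at [ms = (1 - eps) * mts]. *)
Require Import Defs.
From HB Require Import structures.
From mathcomp Require Import all_boot all_order all_algebra.
From mathcomp Require Import all_classical all_reals all_analysis.
From mathcomp Require Import ring lra.

Set Implicit Arguments.
Unset Strict Implicit.
Unset Printing Implicit Defensive.

Import Order.TTheory GRing.Theory Num.Theory.
Import numFieldNormedType.Exports.

Local Open Scope classical_set_scope.
Local Open Scope ring_scope.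

(** * Entropy of the phase error *)

Section Entropy.
Context {R : realType}.
Implicit Types a b p q x y : R.

Lemma ln2_gt0 : 0 < ln 2 :> R.
Proof. by rewrite ln_gt0// ltr1n. Qed.

(** This is [ln t <= t - 1] at [t = y / x], multiplied by [x]: the contribution of one outcome to
    Gibbs' inequality. At [x = 0] the left side vanishes. *)
Lemma mul_ln_le_sub x y : 0 <= x -> 0 < y -> x * ln y - x * ln x <= y - x.
Proof.
rewrite le_eqVlt => /predU1P[<- y0|x0 y0]; first by rewrite !mul0r !subr0 ltW.
rewrite -mulrBr -ln_div// [leRHS](_ : _ = x * (y / x - 1)); last first.
  by field; rewrite gt_eqF.
rewrite ler_pM2l//; have /le_ln1Dx : -1 < y / x - 1.
  by rewrite ltrBDr addrC subrr divr_gt0.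
by rewrite addrC subrK.
Qed.

Lemma h_mul_ln2 p : h p * ln 2 = - (p * ln p) - (1 - p) * ln (1 - p).
Proof. by rewrite /h; field; rewrite gt_eqF// ln2_gt0. Qed.

(** The bounds of [mul_ln_le_sub] for the two outcomes add up, and their right-hand sides [q - p]
    and [p - q] cancel. *)
Lemma h_le_cross_entropy p q : 0 <= p <= 1 -> 0 < q < 1 ->
  h p <= - p * (ln q / ln 2) - (1 - p) * (ln (1 - q) / ln 2).
Proof.
move=> /andP[p0 p1] /andP[q0 q1].
rewrite -(ler_pM2r ln2_gt0) h_mul_ln2 [leRHS](_ : _ =
  - (p * ln q) - (1 - p) * ln (1 - q)); last first.
  by field; rewrite gt_eqF// ln2_gt0.
have A := @mul_ln_le_sub p q p0 q0.
have B : (1 - p) * ln (1 - q) - (1 - p) * ln (1 - p) <= (1 - q) - (1 - p).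
  by apply: mul_ln_le_sub; rewrite ?subr_ge0 ?subr_gt0.
lra.
Qed.

Lemma h0 : h 0 = 0 :> R.
Proof. by rewrite /h [1 - 0](_ : _ = 1) ?ln1; ring. Qed.

Lemma h_ge0 p : 0 <= p <= 1 -> 0 <= h p.
Proof.
move=> /andP[p0 p1]; rewrite -(pmulr_lge0 _ ln2_gt0) h_mul_ln2.
rewrite -mulrN; apply: addr_ge0; last rewrite -mulrN; last first.
  by rewrite mulr_ge0 ?subr_ge0// oppr_ge0 ln_le0// gerBl.
by rewrite mulr_ge0// oppr_ge0 ln_le0.
Qed.

Lemma ln_half : ln 2^-1 = - ln 2 :> R.
Proof. by rewrite lnV// posrE. Qed.

Lemma h_half : h 2^-1 = 1 :> R.
Proof.
have l2 := ln2_gt0; apply: (mulIf (lt0r_neq0 l2)); rewrite h_mul_ln2.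
have -> : 1 - 2^-1 = 2^-1 :> R by field.
by rewrite ln_half; field.
Qed.

Lemma h_le1 p : 0 <= p <= 1 -> h p <= 1.
Proof.
move=> p01; have := @h_le_cross_entropy p 2^-1 p01.
have -> : 1 - 2^-1 = 2^-1 :> R by field.
rewrite invr_gt0 invf_lt1// ltr1n ltr0n => /(_ isT)/le_trans; apply.
by rewrite ln_half -mulrBl mulNr divff ?gt_eqF ?ln2_gt0//; lra.
Qed.

Lemma mul_ln_lt_sub x y : 0 < x -> 0 < y -> x != y ->
  x * ln y - x * ln x < y - x.
Proof.
move=> x0 y0 xy; rewrite -mulrBr -ln_div// [ltRHS](_ : _ = x * (y / x - 1)); last first.
  by field; rewrite gt_eqF.
have yx0 : 0 < y / x by rewrite divr_gt0.
rewrite ltr_pM2l// ltrBrDl -[ltRHS]lnK// expR_gt1Dx// ln_eq0//.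
by apply: contraNneq xy => E; rewrite -[y](divfK (lt0r_neq0 x0)) E mul1r.
Qed.

(** Gibbs' inequality against the uniform distribution, strict for the outcome [1 - p], which
    differs from 1/2. It makes the limiting key fraction positive, hence a legitimate divisor. *)
Lemma h_lt1 p : 0 <= p -> p < 2^-1 -> h p < 1.
Proof.
move=> p0 p2; have l2 := ln2_gt0.
rewrite -(ltr_pM2r l2) h_mul_ln2 mul1r.
have half0 : 0 < 2^-1 :> R by rewrite invr_gt0.
have := mul_ln_le_sub p0 half0.
have : (1 - p) * ln 2^-1 - (1 - p) * ln (1 - p) < 2^-1 - (1 - p).
  by apply: mul_ln_lt_sub => //; [lra|rewrite gt_eqF//; lra].
rewrite ln_half; lra.
Qed.

Lemma h_phaseE p : p <= 2^-1 -> h_phase p = h p.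
Proof. by move=> p2; rewrite /h_phase min_l. Qed.

Lemma h_phase_half p : 2^-1 <= p -> h_phase p = 1.
Proof. by move=> p2; rewrite /h_phase min_r// h_half. Qed.

Lemma min_half01 p : 0 <= p -> 0 <= Num.min p 2^-1 <= 1.
Proof.
by move=> p0; rewrite le_min p0 ge_min invr_ge0 ler0n/= invf_le1 ?ler1n ?orbT.
Qed.

Lemma h_phase_ge0 p : 0 <= p -> 0 <= h_phase p.
Proof. by move=> /min_half01/h_ge0. Qed.

Lemma h_phase_le1 p : 0 <= p -> h_phase p <= 1.
Proof. by move=> /min_half01/h_le1. Qed.

Lemma continuous_mul_ln : continuous (fun x : R => x * ln x).
Proof.
move=> x; have [x0|x0|->] := ltgtP x 0.
- rewrite /continuous_at ln0 ?mulr0 ?ltW//.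
  apply: cvg_near_cst; near=> z; rewrite ln0 ?mulr0// ltW//.
  by near: z; exact: lt_nbhsl.
- by apply: cvgM; [exact: cvg_id|exact: continuous_ln].
rewrite /continuous_at mul0r.
have c0 : 2 * Num.sqrt z @[z --> (0 : R)] --> (0 : R).
  rewrite [X in _ --> X](_ : _ = 2 * Num.sqrt 0); last by rewrite sqrtr0 mulr0.
  by apply: cvgM; [exact: cvg_cst|exact: sqrt_continuous].
(* To the right of 0, with [w = Num.sqrt z], the bound [- (w * ln w) <= 1 - w] yields
   [- (z * ln z) <= 2 * w]; to the left, [ln] is 0 by default. *)
apply: (@squeeze_cvgr _ _ _ _ (fun x => - (2 * Num.sqrt x)) (fun x => 2 * Num.sqrt x)).
- near=> z.
  have [z0|z0] := leP z 0; first by rewrite ln0// mulr0 oppr_le0 mulr_ge0// sqrtr_ge0.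
  have z1 : ln z <= 0.
    by rewrite ln_le0// ltW//; near: z; exact: lt_nbhsl.
  apply/andP; split; last first.
    apply: (@le_trans _ _ 0); last by rewrite mulr_ge0// sqrtr_ge0.
    by rewrite mulr_ge0_le0// ltW.
  have s0 : 0 < Num.sqrt z by rewrite sqrtr_gt0.
  have E : z = Num.sqrt z ^+ 2 by rewrite sqr_sqrtr// ltW.
  have := @mul_ln_le_sub (Num.sqrt z) 1 (ltW s0) ltr01.
  rewrite ln1 mulr0 sub0r => A.
  move: s0 E A; move: (Num.sqrt z) => w w0 -> A.
  rewrite lnXn// mulr2n expr2.
  have : w * - (w * ln w) <= w * (1 - w) by rewrite ler_pM2l.
  have := sqr_ge0 w; rewrite expr2; lra.
- by rewrite -[X in _ --> X]oppr0; exact: cvgN.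
- exact: c0.
Unshelve. all: by end_near. Qed.

Lemma continuous_h : continuous (@h R).
Proof.
have -> : @h R = fun p => - (p * ln p / ln 2) - (1 - p) * ln (1 - p) / ln 2.
  by apply/funext => p; rewrite /h; field; rewrite gt_eqF// ln2_gt0.
move=> p; apply: cvgB.
  apply: cvgN; apply: cvgM; last exact: cvg_cst.
  exact: continuous_mul_ln.
apply: cvgM; last exact: cvg_cst.
apply: (@continuous_comp _ _ _ (fun p => 1 - p) (fun x => x * ln x)).
  by apply: cvgB; [exact: cvg_cst|exact: cvg_id].
exact: continuous_mul_ln.
Qed.

Lemma continuous_h_phase : continuous (@h_phase R).
Proof.
move=> p; apply: (@continuous_comp _ _ _ (fun p => Num.min p 2^-1) (@h R)).
  by apply: (@continuous_min _ _ id (cst 2^-1)); [exact: cvg_id|exact: cvg_cst].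
exact: continuous_h.
Qed.

(** The extreme value theorem will turn worst-case rates into minima; it needs continuity even where
    the estimated detection rate is zero. *)
Lemma continuous_key_fraction (T : topologicalType) (a b : T -> R) t :
  (forall u, 0 <= a u) -> (forall u, 0 <= b u) ->
  {for t, continuous a} -> {for t, continuous b} ->
  {for t, continuous (fun u => a u * (1 - h_phase (b u / a u)))}.
Proof.
move=> a0 b0 ca cb; have [at0|at0] := eqVneq (a t) 0; last first.
  apply: cvgM => //; apply: cvgB; first exact: cvg_cst.
  apply: (@continuous_comp _ _ _ (fun u => b u / a u) (@h_phase R)).
    by apply: cvgM => //; exact: cvgV.
  exact: continuous_h_phase.
(* Here [b u / a u] may diverge, but the product lies between [0] and [a u]. *)
change (a u * (1 - h_phase (b u / a u)) @[u --> t]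
  --> a t * (1 - h_phase (b t / a t))).
rewrite [X in _ --> X](_ : _ = 0); last by rewrite at0 mul0r.
apply: (@squeeze_cvgr _ _ _ _ (cst 0) a).
- near=> u; have q0 : 0 <= b u / a u by rewrite divr_ge0.
  rewrite /= mulr_ge0 ?subr_ge0 ?h_phase_le1//= ler_piMr//.
  by rewrite gerBl h_phase_ge0.
- exact: cvg_cst.
- by rewrite -[X in _ --> X]at0.
Unshelve. all: by end_near. Qed.

(** The signs come from [1/2 <= 1 - q], [q <= 1/2] and [q * (1 - q) <= 1/4]. *)
Lemma log_weights q : 0 < q <= 2^-1 ->
  [/\ 0 <= 1 + ln (1 - q) / ln 2, 1 + ln q / ln 2 <= 0 &
      (1 + ln (1 - q) / ln 2) + (1 + ln q / ln 2) <= 0].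
Proof.
move=> /andP[q0 q2]; have l2 := ln2_gt0.
have q1 : q < 1 by rewrite (le_lt_trans q2)// invf_lt1 ?ltr1n.
split.
- rewrite -(pmulr_lge0 _ l2) mulrDl mul1r divfK ?gt_eqF// -lnM ?posrE ?subr_gt0//.
  by rewrite ln_ge0//; lra.
- by rewrite -(pmulr_lle0 _ l2) mulrDl mul1r divfK ?gt_eqF// -lnM ?posrE// ln_le0//; lra.
rewrite -(pmulr_lle0 _ l2) !mulrDl !mul1r !divfK ?gt_eqF//.
rewrite addrACA -!lnM ?posrE ?mulr_gt0 ?subr_gt0//.
by rewrite ln_le0//; have := sqr_ge0 (q - 2^-1); rewrite expr2; nra.
Qed.

Lemma key_fraction_gibbs a b q : 0 <= a -> 0 <= b -> 0 < q <= 2^-1 ->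
  (a - b) * (1 + ln (1 - q) / ln 2) + b * (1 + ln q / ln 2)
    <= a * (1 - h_phase (b / a)).
Proof.
move=> a0 b0 q02; have [L1 _ L3] := log_weights q02; move/andP: q02 => [q0 q2].
have half1 : 2^-1 < 1 :> R by rewrite invf_lt1 ?ltr1n.
have q1 : q < 1 by exact: le_lt_trans half1.
have [ab|ab] := leP b (a / 2).
  move: a0; rewrite le_eqVlt => /predU1P[a0|a0].
    have -> : b = 0 by apply/le_anti; rewrite b0 andbT (le_trans ab)// -a0 mul0r.
    by rewrite -a0 subrr !mul0r addr0.
  have ba : b / a <= 2^-1 by rewrite ler_pdivrMr// mulrC.
  rewrite h_phaseE//; set p := b / a.
  have -> : b = a * p by rewrite /p; field; rewrite gt_eqF.
  have : h p <= - p * (ln q / ln 2) - (1 - p) * (ln (1 - q) / ln 2).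
    apply: h_le_cross_entropy; last by rewrite q0.
    by rewrite divr_ge0 ?(ltW a0)//= (le_trans ba)// ltW.
  move=> /(ler_wpM2l (ltW a0)); lra.
have b0' : 0 < b by apply: le_lt_trans ab; rewrite divr_ge0.
have -> : a * (1 - h_phase (b / a)) = 0.
  move: a0; rewrite le_eqVlt => /predU1P[<-|a0]; first by rewrite mul0r.
  by rewrite h_phase_half ?subrr ?mulr0// ler_pdivlMr// mulrC ltW.
have /(ler_wpM2r L1) : a - b <= b by lra.
have : b * (1 + ln (1 - q) / ln 2 + (1 + ln q / ln 2)) <= 0.
  by rewrite pmulr_rle0.
lra.
Qed.

Lemma key_fraction_gibbs_eq a b : a != 0 -> b / a <= 2^-1 ->
  a * (1 - h_phase (b / a)) =
  (a - b) * (1 + ln (1 - b / a) / ln 2) + b * (1 + ln (b / a) / ln 2).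
Proof.
move=> a0 q2; rewrite h_phaseE// /h; set q := b / a.
have -> : b = a * q by rewrite /q; field.
by ring.
Qed.

Lemma key_fraction_no_error a : a * (1 - h_phase (0 / a)) = a.
Proof. by rewrite mul0r h_phaseE ?invr_ge0// h0 subr0 mulr1. Qed.

Lemma key_fraction_ge0 a b : 0 <= a -> 0 <= b ->
  0 <= a * (1 - h_phase (b / a)).
Proof.
by move=> a0 b0; rewrite mulr_ge0// subr_ge0 h_phase_le1// divr_ge0.
Qed.

(** The linear function that is tight at [q = b / a] is compared at the two points, its weights
    having the right signs. The ratio 0 is treated apart, since Gibbs' bound requires a positive
    [q]. *)
Lemma key_fraction_mono a b a' b' : 0 <= a -> 0 <= b' -> 0 <= a' ->
  b' <= b -> a - b <= a' - b' ->
  a * (1 - h_phase (b / a)) <= a' * (1 - h_phase (b' / a')).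
Proof.
move=> a0 b'0 a'0 bb ab; have b0 : 0 <= b by exact: le_trans bb.
have rhs0 := key_fraction_ge0 a'0 b'0.
move: a0; rewrite le_eqVlt => /predU1P[<-|a0]; first by rewrite mul0r.
have [q2|q2] := leP (b / a) 2^-1; last by rewrite h_phase_half ?subrr ?mulr0// ltW.
move: b0; rewrite le_eqVlt => /predU1P[b0|b0].
  have b'E : b' = 0 by apply/le_anti; rewrite b'0 b0 bb.
  by move: ab; rewrite -b0 b'E !key_fraction_no_error !subr0.
have q02 : 0 < b / a <= 2^-1 by rewrite divr_gt0.
have [L1 L2 _] := log_weights q02.
rewrite key_fraction_gibbs_eq ?gt_eqF//.
apply: le_trans (key_fraction_gibbs a'0 b'0 q02).
by apply: lerD; [exact: ler_wpM2r|exact: ler_wnM2r].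
Qed.

(** One [K] serves all estimates because the linear function is frozen at the limiting ratio; [u]
    may exceed [beta], and [r] absorbs the errors. The last premise covers an error-free limit,
    where that ratio is 0 and Gibbs' bound does not apply. *)
Lemma key_fraction_lower s p0 beta : 0 <= s -> s < 1 / 2 -> 0 <= p0 -> 0 < beta ->
  exists2 K, 0 <= K & forall a b u r, 0 <= a -> 0 <= b -> 0 <= r ->
    beta - r <= u -> (1 - s) * u + p0 / 2 - r <= a - b ->
    b <= s * u + p0 / 2 + r -> (s * beta + p0 / 2 = 0 -> b = 0) ->
    (beta + p0) * (1 - h_phase ((s * beta + p0 / 2) / (beta + p0))) - K * r
      <= a * (1 - h_phase (b / a)).
Proof.
move=> s0 s2 p00 be0; set a0 := beta + p0; set b0 := s * beta + p0 / 2.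
have sb0 : 0 <= s * beta by rewrite mulr_ge0// ltW.
have sb2 : s * beta <= beta / 2 by rewrite mulrC ler_wpM2l ?ltW//; lra.
have a00 : 0 < a0 by rewrite /a0; lra.
have b00 : 0 <= b0 by rewrite /b0; lra.
have q2 : b0 / a0 <= 2^-1 by rewrite ler_pdivrMr// /a0 /b0; lra.
move: (b00); rewrite le_eqVlt => /predU1P[b0E|b0_gt0].
  have p0E : p0 = 0 by move: b0E; rewrite /b0; lra.
  have sE : s = 0.
    have /eqP : s * beta = 0 by move: b0E; rewrite /b0; lra.
    by rewrite mulf_eq0 (gt_eqF be0) orbF => /eqP.
  (* The constant comes from the chain [a >= u - r >= beta - 2 * r]. *)
  exists 2; first by [].
  move=> a b u r _ _ _ ur ab _ /(_ (esym b0E)) bE.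
  move: ab; rewrite -b0E bE !key_fraction_no_error /a0 p0E sE; lra.
have q02 : 0 < b0 / a0 <= 2^-1 by rewrite divr_gt0.
have [] := log_weights q02.
have := key_fraction_ge0 (ltW a00) b00.
rewrite (key_fraction_gibbs_eq _ q2) ?gt_eqF//.
have := key_fraction_gibbs _ _ q02.
set k := 1 + ln (b0 / a0) / ln 2; set l := 1 + ln (1 - _) / _.
move=> G phi0 l0 k0 lk.
(* At [u = beta] the linear function equals the limiting key fraction, which is nonnegative, while
   its constant term [p0 / 2 * (l + k)] is nonpositive; so its slope in [u] is nonnegative. *)
have slope0 : 0 <= (1 - s) * l + s * k.
  rewrite -(pmulr_rge0 _ be0).
  have : p0 / 2 * (l + k) <= 0 by rewrite mulr_ge0_le0// divr_ge0.
  by move: phi0; rewrite /a0 /b0; lra.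
(* The three premises containing [r] lose at most [l * r], [- k * r] and the slope times [r]. *)
exists (l - k + ((1 - s) * l + s * k)); first by lra.
move=> a b u r a_ge0 b_ge0 r0 ur ab bu _.
apply: le_trans (G _ _ a_ge0 b_ge0).
have := ler_wpM2r l0 ab; have := ler_wnM2r k0 bu; have := ler_wpM2l slope0 ur.
rewrite /a0 /b0; lra.
Qed.

End Entropy.

(** * Two-decoy estimates *)

Section Decoy.
Context {R : realType}.
Implicit Types alpha beta m q u v w x y : R.

(* Termwise on the power series: the terms of order k >= 2 have nonnegative
   coefficients and [x ^+ 2 * y ^+ k <= y ^+ 2 * x ^+ k]. *)
Lemma expR_diff_extrapolation beta x y : 0 <= beta <= 1 -> 0 < y <= x ->
  x ^+ 2 * (expR y - expR ((1 - beta) * y))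
    - y ^+ 2 * (expR x - expR ((1 - beta) * x)) <= beta * (y * x * (x - y)).
Proof.
move=> /andP[b0 b1] /andP[y0 yx]; have x0 : 0 < x by exact: lt_le_trans yx.
pose S t := fun n => series (exp_coeff t) n - series (exp_coeff ((1 - beta) * t)) n.
have cS t : S t n @[n --> \oo] --> expR t - expR ((1 - beta) * t).
  by apply: cvgB; exact: is_cvg_series_exp_coeff.
apply: (@cvgr_to_le _ \oo _ _ (fun n => x ^+ 2 * S y n - y ^+ 2 * S x n)).
  exact: (cvgB (cvgM (cvg_cst _) (cS y)) (cvgM (cvg_cst _) (cS x))).
have rhs0 : 0 <= beta * (y * x * (x - y)).
  by rewrite mulr_ge0// mulr_ge0 ?subr_ge0// ltW// mulr_gt0.
have SE t n : S t n.+1 = S t n + (1 - (1 - beta) ^+ n) * (t ^+ n / n`!%:R).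
  rewrite /S /series/= !big_nat_recr//= /exp_coeff/= exprMn; ring.
have S1 t : S t 1%N = 0.
  by rewrite SE expr0 subrr mul0r addr0 /S /series/= !big_geq// subrr.
apply: nearW => -[|]; first by rewrite /S /series/= !big_geq// subrr !mulr0 subrr.
(* With two terms the claim is an equality, because only order 1 contributes, with
   [S t 2 = beta * t]; every later term lowers the left side. *)
elim=> [|[|n] IH]; first by rewrite !S1 !mulr0 subrr.
  by rewrite ![S _ 2%N]SE !S1 !expr1 !divr1; lra.
apply: le_trans IH; rewrite 2![S _ n.+3]SE.
have f0 : 0 <= (n.+2)`!%:R^-1 :> R by rewrite invr_ge0.
have c0 : 0 <= 1 - (1 - beta) ^+ n.+2.
  by rewrite subr_ge0 exprn_ile1 ?subr_ge0// gerBl.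
have yx' : x ^+ 2 * y ^+ n.+2 <= y ^+ 2 * x ^+ n.+2.
  have E z : z ^+ n.+2 = z ^+ 2 * z ^+ n by rewrite -exprD.
  by rewrite !E mulrCA !ler_wpM2l ?sqr_ge0// lerXn2r// nnegrE ltW.
have : 0 <= (n.+2)`!%:R^-1 * (1 - (1 - beta) ^+ n.+2) *
    (y ^+ 2 * x ^+ n.+2 - x ^+ 2 * y ^+ n.+2).
  by rewrite !mulr_ge0// subr_ge0.
lra.
Qed.

Definition click alpha m : R := 1 - expR (- (alpha * m)).

(* A pulse of intensity [y] is the vacuum with probability [expR (- y)]: this is
   [expR y] times the rate [w * q + v] of some event, minus the contribution of
   the vacuum, for which the rate is [v]. The pairs [(1, p0)], [(s, p0 / 2)] and
   [(1 - s, p0 / 2)] for [(w, v)] give [f_a], [f_b] and [f_c]. *)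
Definition nonvacuum w v q y : R := expR y * (w * q + v) - v.

Definition decoy_estimate w v qd qs y x : R :=
  (x ^+ 2 * nonvacuum w v qd y - y ^+ 2 * nonvacuum w v qs x)
    / (y * x * (x - y)).

Lemma click_ge0 alpha m : 0 <= alpha * m -> 0 <= click alpha m.
Proof. by move=> am; rewrite subr_ge0 expR_le1 oppr_le0. Qed.

Lemma click_le1 alpha m : click alpha m <= 1.
Proof. by rewrite gerBl expR_ge0. Qed.

Lemma click_le alpha m : click alpha m <= alpha * m.
Proof. by have := expR_ge1Dx (- (alpha * m)); rewrite /click; lra. Qed.

Lemma click_ge alpha m : 0 <= alpha * m ->
  alpha * m / (1 + alpha * m) <= click alpha m.
Proof.
move=> am; have am1 : 0 < 1 + alpha * m by lra.
rewrite ler_pdivrMr// /click; set z := alpha * m in am am1 *.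
have : expR (- z) * (1 + z) <= 1.
  by rewrite expRN ler_pdivrMl ?expR_gt0// mulr1 expR_ge1Dx.
lra.
Qed.

Lemma expR_click beta y :
  expR y * (1 - expR (- (beta * y))) = expR y - expR ((1 - beta) * y).
Proof. by rewrite mulrBr mulr1 -expRD; congr (_ - expR _); ring. Qed.

Lemma nonvacuum_le w v q q' y : 0 <= w -> q <= q' ->
  nonvacuum w v q y <= nonvacuum w v q' y.
Proof.
by move=> w0 qq; rewrite lerD2r ler_pM2l ?expR_gt0// lerD2r ler_wpM2l.
Qed.

Lemma nonvacuum_ge w v q y : 0 <= y -> 0 <= w -> 0 <= v -> 0 <= q ->
  w * q + v * y <= nonvacuum w v q y.
Proof.
move=> y0 w0 v0 q0; have e1 := expR_ge1Dx y.
have : (1 + y) * (w * q + v) <= expR y * (w * q + v).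
  by rewrite ler_wpM2r// addr_ge0// mulr_ge0.
have : 0 <= y * (w * q) by rewrite !mulr_ge0.
rewrite /nonvacuum; lra.
Qed.

(** The click part factors as [expR ((1 - beta) * y) * (expR (beta * y) - 1)], whose first factor is
    at least 1 and whose second is at least [beta * y]. *)
Lemma nonvacuum_click_ge w v beta y : 0 <= y -> 0 <= w -> 0 <= v -> 0 <= beta <= 1 ->
  (w * beta + v) * y <= nonvacuum w v (1 - expR (- (beta * y))) y.
Proof.
move=> y0 w0 v0 /andP[b0 b1]; have := expR_click beta y.
have -> : expR y - expR ((1 - beta) * y) = expR ((1 - beta) * y) * (expR (beta * y) - 1).
  by rewrite mulrBr mulr1 -expRD; congr (expR _ - _); ring.
move=> E; have : beta * y <= expR ((1 - beta) * y) * (expR (beta * y) - 1).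
  rewrite (@le_trans _ _ (1 * (expR (beta * y) - 1)))//.
    by have := expR_ge1Dx (beta * y); lra.
  have by0 : 0 <= beta * y by rewrite mulr_ge0.
  have by1 : 0 <= (1 - beta) * y by rewrite mulr_ge0 ?subr_ge0.
  by rewrite ler_wpM2r ?subr_ge0// -[leLHS]expR0 ler_expR.
rewrite -E => /(ler_wpM2l w0); have /(ler_wpM2l v0) := expR_ge1Dx y.
rewrite /nonvacuum; lra.
Qed.

Lemma nonvacuum_upper w v q y : 0 <= v ->
  nonvacuum w v q y <= expR y * (w * q + v * y).
Proof.
move=> v0; have : expR y * (1 - y) <= 1.
  have := expR_ge1Dx (- y).
  by rewrite -(ler_pM2l (expR_gt0 y)) -expRD subrr expR0.
by move=> /(ler_wpM2l v0); rewrite /nonvacuum; lra.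
Qed.

(** Each [nonvacuum] splits into a part of weight [w] and a part of weight [v], to which
    [expR_diff_extrapolation] applies with [beta] and with 1. The signal enters with a minus sign,
    so an inequality suffices for it. *)
Lemma decoy_estimate_upper w v alpha beta mts mtd x y :
  0 <= w -> 0 <= v -> 0 <= beta <= 1 -> 0 < y < x ->
  alpha * mtd = beta * y -> beta * x <= alpha * mts ->
  decoy_estimate w v (click alpha mtd) (click alpha mts) y x <= w * beta + v.
Proof.
move=> w0 v0 b01 /andP[y0 yx] Ed Es; have x0 : 0 < x by exact: lt_trans yx.
rewrite ler_pdivrMr ?mulr_gt0 ?subr_gt0//.
have y0x : 0 < y <= x by rewrite y0 ltW.
have A := ler_wpM2l w0 (expR_diff_extrapolation b01 y0x).
have /(_ _) := @expR_diff_extrapolation 1 x y _ y0x.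
rewrite ler01 lexx => /(_ isT); rewrite subrr !mul0r expR0 => /(ler_wpM2l v0) B.
have E z : nonvacuum w v (1 - expR (- (beta * z))) z =
    w * (expR z - expR ((1 - beta) * z)) + v * (expR z - 1).
  by rewrite /nonvacuum -expR_click; ring.
have -> : click alpha mtd = 1 - expR (- (beta * y)) by rewrite /click Ed.
have : nonvacuum w v (1 - expR (- (beta * x))) x <= nonvacuum w v (click alpha mts) x.
  by apply: nonvacuum_le => //; rewrite lerD2l lerN2 ler_expR lerN2.
move: (nonvacuum w v (click alpha mts) x) => N.
rewrite !E => /(ler_wpM2l (sqr_ge0 y)).
move: (expR y) (expR x) A B => Y X.
move: (expR _) (expR _) => Y' X'; lra.
Qed.

Lemma decoy_estimate_lower w v qd qs y x : 0 < y < x ->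
  0 <= nonvacuum w v qd y ->
  nonvacuum w v qd y / y - y / (x - y) * (nonvacuum w v qs x / x)
    <= decoy_estimate w v qd qs y x.
Proof.
move=> /andP[y0 yx] n0; have x0 : 0 < x by exact: lt_trans yx.
have d0 : 0 < x - y by rewrite subr_gt0.
rewrite [leRHS](_ : _ = nonvacuum w v qd y / y
  - y / (x - y) * (nonvacuum w v qs x / x) + nonvacuum w v qd y / (x - y)).
  by rewrite lerDl divr_ge0// ltW.
by rewrite /decoy_estimate; field; rewrite !gt_eqF.
Qed.

End Decoy.

(** * Suprema of worst-case rates *)

Section WorstCase.
Context {R : realType}.
Implicit Types (D : set R) (rate : R -> R -> R -> R -> R) (eps mts L : R).

Lemma true_intensitiesP eps mt m :
  true_intensities eps mt m <-> (1 - eps) * mt <= m <= (1 + eps) * mt.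
Proof. by rewrite /true_intensities/= in_itv. Qed.

Lemma true_intensities_ends eps mt : 0 <= eps -> 0 <= mt ->
  true_intensities eps mt ((1 - eps) * mt) /\
  true_intensities eps mt ((1 + eps) * mt).
Proof.
move=> e0 m0; have le : (1 - eps) * mt <= (1 + eps) * mt.
  by rewrite ler_wpM2r//; lra.
by rewrite !true_intensitiesP !lexx le.
Qed.

(** The corner lies in the rectangle of true intensities, so the worst-case rate and the corner rate
    are both squeezed between [L - K * m] and [L]; the bound [L] is needed only at the corner. *)
Lemma sup_is_limit_at0_linear D rate eps mts L K m0 :
  0 <= eps -> 0 <= mts -> 0 <= K -> 0 < m0 ->
  (forall m, D m -> 0 < m) ->
  (forall m, D m -> exists2 z,
     (true_intensities eps mts `*` true_intensities eps m) z &
     forall z', (true_intensities eps mts `*` true_intensities eps m) z' ->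
       rate z.1 z.2 mts m <= rate z'.1 z'.2 mts m) ->
  (forall m, D m -> rate ((1 - eps) * mts) ((1 + eps) * m) mts m <= L) ->
  (forall m, 0 < m -> m < m0 -> D m) ->
  (forall m ms md, 0 < m -> m < m0 ->
     true_intensities eps mts ms -> true_intensities eps m md ->
     L - K * m <= rate ms md mts m) ->
  sup_is_limit_at0 D rate eps mts L.
Proof.
move=> e0 mts0 K0 m0_gt0 D0 Dmin Dup Dnear Dlow.
have worst m : D m -> exists2 z,
    (true_intensities eps mts `*` true_intensities eps m) z &
    worst_rate rate eps mts m = rate z.1 z.2 mts m /\
    lbound (rate_values rate eps mts m) (rate z.1 z.2 mts m).
  move=> /Dmin[z zr zmin]; exists z => //.
  have lb : lbound (rate_values rate eps mts m) (rate z.1 z.2 mts m).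
    by move=> _ [z' z'r <-]; exact: zmin.
  split=> //; apply/le_anti/andP; split.
    by apply: ge_inf; [exists (rate z.1 z.2 mts m)|exists z].
  by apply: lb_le_inf; [exists (rate z.1 z.2 mts m); exists z|].
have corner m : D m -> worst_rate rate eps mts m <=
    rate ((1 - eps) * mts) ((1 + eps) * m) mts m.
  move=> Dm; have [z zr [-> lb]] := worst m Dm; apply: lb.
  exists ((1 - eps) * mts, (1 + eps) * m) => //=.
  have [? _] := true_intensities_ends e0 mts0.
  by have [_ ?] := true_intensities_ends e0 (ltW (D0 _ Dm)).
have low m : 0 < m -> m < m0 -> L - K * m <= worst_rate rate eps mts m.
  move=> mp mm0; have [[x y] [/= zx zy] [-> _]] := worst m (Dnear m mp mm0).
  exact: Dlow.
have cvL : L - K * m @[m --> (0 : R)^'+] --> L.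
  rewrite [X in _ --> X](_ : _ = L - K * 0); last by rewrite mulr0 subr0.
  apply: cvgB; first exact: cvg_cst.
  apply: cvgM; first exact: cvg_cst.
  by apply: cvg_at_right_filter; exact: cvg_id.
have squeeze (f : R -> R) :
    (forall m, 0 < m -> m < m0 -> L - K * m <= f m <= L) ->
    f m @[m --> (0 : R)^'+] --> L.
  move=> fL; apply: (squeeze_cvgr _ cvL (cvg_cst L)).
  near=> m; apply: fL.
    by near: m; exact: nbhs_right_gt.
  by near: m; exact: nbhs_right_lt.
split.
- move=> m Dm; have [z zr [-> lb]] := worst m Dm; split=> //.
  by exists z.
- apply/le_anti/andP; split.
    apply: ge_ereal_sup => _ [m Dm <-]; rewrite lee_fin.
    exact: le_trans (corner m Dm) (Dup m Dm).
  apply/lee_addgt0Pr => e ep.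
  (* This choice gives [m < m0] and [K * m <= e]; the divisor is [K + 1] because [K] may be 0. *)
  pose m := Num.min (m0 / 2) (e / (K + 1)).
  have K1 : 0 < K + 1 by lra.
  have mp : 0 < m by rewrite /m lt_min !divr_gt0.
  have mm0 : m < m0 by rewrite /m gt_min; apply/orP; left; lra.
  have Km : K * m <= e.
    have /(ler_wpM2l (ltW K1)) : m <= e / (K + 1) by rewrite /m ge_min lexx orbT.
    by rewrite [(K + 1) * (_ / _)]mulrC divfK ?gt_eqF//; lra.
  apply: (@le_trans _ _ ((worst_rate rate eps mts m)%:E + e%:E)%E).
    by rewrite -EFinD lee_fin; have := low m mp mm0; lra.
  by rewrite leeD2r//; apply: ereal_sup_ubound; exists m => //; exact: Dnear.
- apply: squeeze => m mp mm0; have Dm := Dnear m mp mm0.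
  by rewrite low//= (le_trans (corner m Dm) (Dup m Dm)).
- apply: squeeze => m mp mm0; have Dm := Dnear m mp mm0.
  by rewrite (le_trans (low _ mp mm0) (corner m Dm))/= Dup.
Unshelve. all: by end_near. Qed.

(** The derivative [(k - (t * k + p)) * expR (- t)] is nonnegative for [t <= y]. *)
Lemma mul_expRN_le (k p x y : R) : 0 <= p -> 0 <= k -> 0 <= x -> x <= y -> y - x < 1 ->
  y * k + p <= k ->
  (x * k + p) * expR (- x) <= (y * k + p) * expR (- y).
Proof.
move=> p0 k0 x0 xy y1 yk; set d := y - x.
have d0 : 0 <= d by rewrite subr_ge0.
have d1 : 0 < 1 - d by rewrite /d; lra.
have E : expR (- x) = expR d * expR (- y).
  by rewrite -expRD; congr expR; rewrite /d; ring.
rewrite E mulrA ler_wpM2r ?expR_ge0//.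
(* [e^d <= 1 / (1 - d)] reduces the claim to [0 <= d * (k - (y * k + p))]. *)
have ed : expR d * (1 - d) <= 1.
  have := expR_ge1Dx (- d).
  by rewrite -(ler_pM2l (expR_gt0 d)) -expRD subrr expR0.
rewrite -(ler_pM2r d1).
have xk0 : 0 <= x * k + p by rewrite addr_ge0// mulr_ge0.
have := ler_wpM2l xk0 ed; rewrite mulr1 mulrA => /le_trans; apply.
have := mulr_ge0 d0 (etrans (subr_ge0 _ _) yk).
by rewrite /d; lra.
Qed.

End WorstCase.

(** * Key rates *)

Section Rates.
Context {R : realType} (alpha s p0 eps mts : R).
Hypotheses (alpha0 : 0 < alpha) (alpha1 : alpha <= 1).
Hypotheses (s0 : 0 <= s) (s2 : s < 1 / 2) (p00 : 0 <= p0).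
Hypotheses (eps0 : 0 < eps) (eps1 : eps < 1) (mts0 : 0 < mts).

Local Notation beta := (alpha / (1 + eps)).

(** * Estimates in terms of click probabilities *)

Lemma det_rateE mt : det_rate alpha p0 mt = click alpha mt + p0.
Proof. by []. Qed.

Lemma det_rate_neq0 mt : 0 < mt -> det_rate alpha p0 mt != 0.
Proof.
move=> mt0; rewrite det_rateE gt_eqF// ltr_pwDl// subr_gt0 expR_lt1 oppr_lt0.
exact: mulr_gt0.
Qed.

Lemma err_rateK mt : 0 < mt ->
  err_rate alpha s p0 mt * det_rate alpha p0 mt = s * click alpha mt + p0 / 2.
Proof. by move=> mt0; rewrite /err_rate divfK ?det_rate_neq0. Qed.

Lemma correct_rateK mt : 0 < mt ->
  (1 - err_rate alpha s p0 mt) * det_rate alpha p0 mt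
    = (1 - s) * click alpha mt + p0 / 2.
Proof.
by move=> mt0; rewrite mulrBl err_rateK// det_rateE; field.
Qed.

Lemma a_hatE ms md mts' mtd : a_hat alpha p0 ms md mts' mtd =
  pos_part (decoy_estimate 1 p0 (click alpha mtd) (click alpha mts') md ms).
Proof.
rewrite /a_hat /f_a /decoy_estimate /nonvacuum !det_rateE !mul1r.
congr pos_part; rewrite !expRN; congr (_ / _).
by field; rewrite !gt_eqF ?expR_gt0.
Qed.

Lemma c_hatE ms md mts' mtd : 0 < mts' -> 0 < mtd ->
  c_hat alpha s p0 ms md mts' mtd =
  pos_part (decoy_estimate (1 - s) (p0 / 2) (click alpha mtd) (click alpha mts') md ms).
Proof.
move=> mts'0 mtd0.
rewrite /c_hat /f_c /decoy_estimate /nonvacuum !correct_rateK//.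
congr pos_part; rewrite !expRN; congr (_ / _).
by field; rewrite !gt_eqF ?expR_gt0.
Qed.

(** The positive part disappears because [nonvacuum_ge] makes the numerator nonnegative. *)
Lemma b_hatE md mtd : 0 < md -> 0 < mtd ->
  b_hat alpha s p0 md mtd = nonvacuum s (p0 / 2) (click alpha mtd) md / md.
Proof.
move=> md0 mtd0; rewrite /b_hat /f_b err_rateK// /pos_part max_l /nonvacuum.
  by rewrite [_ * expR md]mulrC.
have q0 : 0 <= click alpha mtd by rewrite click_ge0// ltW// mulr_gt0.
have p20 : 0 <= p0 / 2 by rewrite divr_ge0.
have := nonvacuum_ge (ltW md0) s0 p20 q0; rewrite /nonvacuum => H.
rewrite divr_ge0 ?(ltW md0)// [_ * expR md]mulrC (le_trans _ H)//.
by rewrite addr_ge0// mulr_ge0// ltW.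
Qed.

Lemma pos_part_ge0 (x : R) : 0 <= pos_part x.
Proof. by rewrite /pos_part le_max lexx orbT. Qed.

Lemma beta_gt0 : 0 < beta.
Proof. by rewrite divr_gt0// addr_gt0. Qed.

Lemma beta01 : 0 <= beta <= 1.
Proof.
have [a1 e0] := (alpha1, eps0).
by rewrite (ltW beta_gt0)/= ler_pdivrMr; lra.
Qed.

Lemma true_intensities_order m ms md : decoys eps mts m ->
  true_intensities eps mts ms -> true_intensities eps m md -> 0 < md < ms.
Proof.
move=> [m0 _ sep] /true_intensitiesP/andP[sl su] /true_intensitiesP/andP[dl du].
rewrite (lt_le_trans _ dl) ?mulr_gt0 ?subr_gt0//=.
exact: le_lt_trans du (lt_le_trans sep sl).
Qed.

(** At this corner [alpha * m = beta * md]: the decoy pulse looks exactly as if the transmission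
    were [beta], while the signal pulse clicks at least as often as that transmission predicts. *)
Lemma decoy_estimate_corner w v m : decoys eps mts m -> 0 <= w -> 0 <= v ->
  pos_part (decoy_estimate w v (click alpha m) (click alpha mts)
    ((1 + eps) * m) ((1 - eps) * mts)) <= w * beta + v.
Proof.
have [e0 M0] := (eps0, mts0).
move=> [m0 _ sep] w0 v0; have e1 : 1 + eps != 0 by rewrite gt_eqF//; lra.
have /andP[b0 b1] := beta01.
rewrite /pos_part ge_max; apply/andP; split; last by rewrite addr_ge0// mulr_ge0.
apply: decoy_estimate_upper => //; first exact: beta01.
- by rewrite sep andbT mulr_gt0//; lra.
- by field.
- rewrite -[leRHS](_ : beta * ((1 + eps) * mts) = _); last by field.
  by rewrite ler_wpM2l// ler_wpM2r ?ltW//; lra.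
Qed.

Lemma b_hat_corner m : decoys eps mts m ->
  s * beta + p0 / 2 <= b_hat alpha s p0 ((1 + eps) * m) m.
Proof.
move=> [m0 _ _]; have e1 : 0 < 1 + eps by rewrite addr_gt0.
have y0 : 0 < (1 + eps) * m by rewrite mulr_gt0.
rewrite b_hatE// ler_pdivlMr// /click.
rewrite -[alpha * m](_ : beta * ((1 + eps) * m) = _); last by field; rewrite gt_eqF.
by apply: nonvacuum_click_ge; [exact: ltW|exact: s0|exact: divr_ge0|exact: beta01].
Qed.

(** The factor 2 keeps every possible [ms - md] at least [(1 - eps) * mts / 2]. *)
Lemma small_decoys m : 0 < m -> m < (1 - eps) * mts / (2 * (1 + eps)) ->
  decoys eps mts m /\ (1 + eps) * m < (1 - eps) * mts / 2.
Proof.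
have [[e0 e1'] M0'] := (eps0, eps1, mts0).
move=> m0; have e1 : 0 < 2 * (1 + eps) by lra.
have M0 : 0 < (1 - eps) * mts by rewrite mulr_gt0// subr_gt0.
rewrite ltr_pdivlMr// => H.
have em : 0 < eps * m by rewrite mulr_gt0.
have eM : 0 < eps * mts by rewrite mulr_gt0.
by split; [split|]; lra.
Qed.

(** Here [u] is [click alpha m / md], the transmission apparent from the true decoy intensity.
    Sharing it among the bounds keeps the estimates correlated: the worst [md] for [b_hat] alone is
    not the worst for [c_hat]. *)
Lemma estimates_near0 : exists2 K, 0 <= K & exists2 m0, 0 < m0 &
  forall m ms md, 0 < m -> m < m0 ->
    true_intensities eps mts ms -> true_intensities eps m md ->
    decoys eps mts m /\ exists u, [/\ beta - K * m <= u,
      b_hat alpha s p0 md m <= s * u + p0 / 2 + K * m,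
      (1 - s) * u + p0 / 2 - K * m <= c_hat alpha s p0 ms md mts m &
      (1 - s) * u + p0 / 2 - K * m
        <= a_hat alpha p0 ms md mts m - b_hat alpha s p0 md m].
Proof.
have [[e0 e1'] M0'] := (eps0, eps1, mts0).
have [[s0' s2'] p00'] := (s0, s2, p00).
have e1 : 0 < 1 + eps by lra.
have e2 : 0 < 1 - eps by lra.
have M0 : 0 < (1 - eps) * mts by rewrite mulr_gt0.
have b0 := beta_gt0.
(* [E] bounds [expR ms] and [expR md], and [U] bounds [u]. *)
pose E := expR ((1 + eps) * mts); have E0 : 0 < E by exact: expR_gt0.
pose U := alpha / (1 - eps); have U0 : 0 < U by rewrite divr_gt0.
(* [K1] pays for the factor [expR md] in [b_hat], [K2] for the signal term of the decoy estimate and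
   [K3] for [click] falling below [alpha * m]. *)
pose K1 := E * (1 + eps) * (s * U + p0 / 2).
pose K2 := (1 + eps) / ((1 - eps) * mts / 2) * (E * (((1 - eps) * mts)^-1 + p0)).
pose K3 := beta * alpha.
have p20 : 0 <= p0 / 2 by rewrite divr_ge0.
have sU0 : 0 <= s * U + p0 / 2 by rewrite addr_ge0// mulr_ge0// ltW.
have half0 : 0 < (1 - eps) * mts / 2 by rewrite divr_gt0.
have Z0 : 0 <= E * (((1 - eps) * mts)^-1 + p0).
  by rewrite mulr_ge0 ?(ltW E0)// addr_ge0// invr_ge0 ltW.
have K10 : 0 <= K1 by rewrite /K1 mulr_ge0// mulr_ge0// ltW.
have K20 : 0 <= K2 by rewrite /K2 mulr_ge0// divr_ge0// ltW.
have K30 : 0 <= K3 by rewrite /K3 mulr_ge0 ?ltW.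
exists (K1 + K2 + K3); first by rewrite !addr_ge0.
exists ((1 - eps) * mts / (2 * (1 + eps))); first by rewrite divr_gt0//; lra.
move=> m ms md m0 mm0 tms tmd; have [dm msmall] := small_decoys m0 mm0.
split=> //; have /andP[md0 mdms] := true_intensities_order dm tms tmd.
move: tms tmd => /true_intensitiesP/andP[sl su] /true_intensitiesP/andP[dl du].
have ms0 : 0 < ms by exact: lt_trans mdms.
have K1m : 0 <= K1 * m by rewrite mulr_ge0// ltW.
have K2m : 0 <= K2 * m by rewrite mulr_ge0// ltW.
have K3m : 0 <= K3 * m by rewrite mulr_ge0// ltW.
set q := click alpha m.
have am0 : 0 < alpha * m by rewrite mulr_gt0.
have q0 : 0 <= q by rewrite click_ge0// ltW.
exists (q / md).
have u0 : 0 <= q / md by rewrite divr_ge0// ltW.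
have uU : q / md <= U.
  rewrite ler_pdivrMr// (le_trans (click_le _ _))//.
  have := ler_wpM2l (ltW U0) dl; apply: le_trans.
  by rewrite /U mulrA divfK ?gt_eqF.
have s1 : 0 <= 1 - s by lra.
have s11 : 1 - s <= 1 by lra.
have estimate w v : 0 <= w -> w <= 1 -> 0 <= v -> v <= p0 ->
    nonvacuum w v q md / md - K2 * m
      <= decoy_estimate w v q (click alpha mts) md ms.
  move=> w0 w1 v0 v1.
  have n0 : 0 <= nonvacuum w v q md.
    apply: le_trans (nonvacuum_ge (ltW md0) w0 v0 q0).
    by rewrite addr_ge0// mulr_ge0// ltW.
  have mdms' : 0 < md < ms by rewrite md0.
  apply: le_trans (decoy_estimate_lower _ mdms' n0).
  rewrite lerD2l lerN2 /K2 [leRHS]mulrAC [_ / _ * m]mulrAC.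
  have gap : 0 < ms - md by lra.
  apply: (@le_trans _ _ (md / (ms - md) * (E * (((1 - eps) * mts)^-1 + p0)))).
    rewrite ler_wpM2l ?divr_ge0 ?(ltW md0) ?(ltW gap)//.
    rewrite ler_pdivrMr// (le_trans (nonvacuum_upper _ _ _ v0))// -mulrA.
    have q1 : 0 <= click alpha mts by rewrite click_ge0// ltW// mulr_gt0.
    apply: ler_pM; rewrite ?expR_ge0// ?ler_expR//.
      by rewrite addr_ge0// mulr_ge0// ltW.
    rewrite mulrDl lerD// ?ler_wpM2r ?(ltW ms0)//.
    apply: (@le_trans _ _ (1 * 1)); first by rewrite ler_pM// click_le1.
    by rewrite mulr1 mulrC ler_pdivlMr// mul1r.
  rewrite ler_wpM2r//.
  have gap' : (1 - eps) * mts / 2 <= ms - md by lra.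
  apply: ler_pM; rewrite ?invr_ge0 ?(ltW md0) ?(ltW gap)//.
  by rewrite lef_pV2 ?posrE.
have ub : beta - K3 * m <= q / md.
  have H := click_ge (ltW am0); rewrite -/q in H.
  rewrite ler_pdivlMr// (le_trans _ H)// ler_pdivlMr; last by lra.
  have bm : (beta - K3 * m) * (1 + alpha * m) <= beta.
    have : 0 <= beta * (alpha * m) * (alpha * m).
      by rewrite (mulr_ge0 (mulr_ge0 (ltW b0) (ltW am0)) (ltW am0)).
    by rewrite /K3; lra.
  rewrite mulrAC; apply: (@le_trans _ _ (beta * md)); first by rewrite ler_wpM2r// ltW.
  rewrite -[leRHS](_ : beta * ((1 + eps) * m) = _); last by field; rewrite gt_eqF.
  by rewrite ler_wpM2l// ltW.
have bb : b_hat alpha s p0 md m <= s * (q / md) + p0 / 2 + K1 * m.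
  rewrite b_hatE// -/q.
  have L : 0 <= s * (q / md) + p0 / 2 by rewrite addr_ge0// mulr_ge0.
  apply: (@le_trans _ _ (expR md * (s * (q / md) + p0 / 2))).
    rewrite ler_pdivrMr// (le_trans (nonvacuum_upper _ _ _ p20))//.
    by rewrite -[leRHS]mulrA ler_pM2l ?expR_gt0// mulrDl -[s * _ * md]mulrA divfK ?gt_eqF.
  have ed : expR md - 1 <= (1 + eps) * m * E.
    have E1 : expR md <= E by rewrite ler_expR; lra.
    have := nonvacuum_upper 0 0 md ler01; rewrite /nonvacuum mul0r !add0r mul1r mulr1.
    move=> /le_trans; apply; rewrite mulrC ler_pM ?expR_ge0//.
    exact: ltW.
  have LU : s * (q / md) + p0 / 2 <= s * U + p0 / 2 by rewrite lerD2r ler_wpM2l.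
  have em0 : 0 <= (1 + eps) * m * E by rewrite !mulr_ge0// ltW.
  have := ler_wpM2r L ed; have := ler_wpM2l em0 LU.
  by rewrite /K1; lra.
have n1 w v : 0 <= w -> 0 <= v -> w * (q / md) + v <= nonvacuum w v q md / md.
  move=> w0 v0; rewrite ler_pdivlMr// mulrDl mulrA divfK ?gt_eqF//.
  by apply: nonvacuum_ge => //; exact: ltW.
have -> : (K1 + K2 + K3) * m = K1 * m + K2 * m + K3 * m by rewrite !mulrDl.
have nc := n1 _ _ s1 p20.
move: (K1 * m) (K2 * m) (K3 * m) K1m K2m K3m ub bb estimate.
move=> k1 k2 k3 k10 k20 k30 ub bb est.
split.
- by move: ub; move: beta (q / md) => b u; lra.
- by move: bb; move: (b_hat _ _ _ _ _) => b; lra.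
- rewrite c_hatE// /pos_part le_max; apply/orP; left.
  have p22 : p0 / 2 <= p0 by lra.
  have := est _ _ s1 s11 p20 p22; move: nc.
  by move: (nonvacuum _ _ _ _ / _) (decoy_estimate _ _ _ _ _ _) => n d; lra.
- rewrite lerBrDr a_hatE /pos_part le_max; apply/orP; left.
  have := est _ _ ler01 (lexx _) p00 (lexx _).
  (* Correct and erroneous events add up to all events, and the erroneous share is exactly [b_hat],
     so the subtraction cancels it without loss. *)
  have -> : nonvacuum 1 p0 q md / md =
      nonvacuum (1 - s) (p0 / 2) q md / md + nonvacuum s (p0 / 2) q md / md.
    by rewrite /nonvacuum; field; rewrite gt_eqF.
  rewrite b_hatE// -/q; move: nc.
  move: (nonvacuum (1 - s) _ _ _ / _) (nonvacuum s _ _ _ / _).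
  by move: (decoy_estimate _ _ _ _ _ _) => d n n'; lra.
Qed.

(** Both inequalities say that the erroneous part is at most the correct one, which in the limit
    holds with the margin [(1 - 2 * s) * beta]. *)
Lemma error_ratio_near0 : exists2 m1, 0 < m1 &
  forall m ms md, 0 < m -> m < m1 ->
    true_intensities eps mts ms -> true_intensities eps m md ->
    [/\ decoys eps mts m,
      b_hat alpha s p0 md m
        <= (c_hat alpha s p0 ms md mts m + b_hat alpha s p0 md m) / 2 &
      b_hat alpha s p0 md m <= a_hat alpha p0 ms md mts m / 2].
Proof.
have [K K0 [m0 m0_gt0 est]] := estimates_near0.
have [[b0 s0'] s2'] := (beta_gt0, s0, s2).
have s20 : 0 < 1 - 2 * s by lra.
have K1 : 0 < 3 * K + 1 by lra.
(* The errors use up at most [3 * K * m] of the margin: [2 * K * m] from the two estimates and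
   [(1 - 2 * s) * K * m] from [u]. Adding 1 keeps the divisor positive. *)
exists (Num.min m0 ((1 - 2 * s) * beta / (3 * K + 1))).
  by rewrite lt_min m0_gt0 divr_gt0// mulr_gt0.
move=> m ms md mp; rewrite lt_min => /andP[mm0]; rewrite ltr_pdivlMr// => mm1 tms tmd.
have [dm [u [ub bb cb ab]]] := est m ms md mp mm0 tms tmd.
have Km : 0 <= K * m by rewrite mulr_ge0// ltW.
have sKm : 0 <= s * (K * m) by rewrite mulr_ge0.
have := ler_wpM2l (ltW s20) ub.
move: beta (b_hat _ _ _ _ _) (c_hat _ _ _ _ _ _ _) (a_hat _ _ _ _ _ _) mm1 bb cb ab.
by move=> be b c a mm1 bb cb ab H; split=> //; lra.
Qed.

(** * Continuity in the true intensities *)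

Lemma continuous_decoy_estimate w v qd qs (z : R * R) : 0 < z.2 < z.1 ->
  {for z, continuous (fun z : R * R => pos_part (decoy_estimate w v qd qs z.2 z.1))}.
Proof.
move=> /andP[y0 yx]; have x0 : 0 < z.1 by exact: lt_trans yx.
have c1 : {for z, continuous (fun z : R * R => z.1)} by exact: cvg_fst.
have c2 : {for z, continuous (fun z : R * R => z.2)} by exact: cvg_snd.
have cN q (f : R * R -> R) : {for z, continuous f} ->
    {for z, continuous (fun z => nonvacuum w v q (f z))}.
  move=> cf; apply: cvgB; last exact: cvg_cst.
  apply: cvgM; last exact: cvg_cst.
  by apply: (continuous_comp cf); exact: continuous_expR.
apply: (@continuous_max _ _ _ (cst 0)); last exact: cvg_cst.
apply: cvgM; first apply: cvgB.
- by apply: cvgM; [exact: cvgM|exact: cN].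
- by apply: cvgM; [exact: cvgM|exact: cN].
- apply: cvgV; first by rewrite !mulf_neq0// ?subr_eq0 gt_eqF.
  by apply: cvgM; [exact: cvgM|exact: cvgB].
Qed.

Lemma continuous_a_hat m (z : R * R) : 0 < z.2 < z.1 ->
  {for z, continuous (fun z : R * R => a_hat alpha p0 z.1 z.2 mts m)}.
Proof.
move=> z0; have -> : (fun z : R * R => a_hat alpha p0 z.1 z.2 mts m) =
    (fun z => pos_part (decoy_estimate 1 p0 (click alpha m) (click alpha mts) z.2 z.1)).
  by apply/funext => z'; rewrite a_hatE.
exact: continuous_decoy_estimate.
Qed.

Lemma continuous_c_hat m (z : R * R) : 0 < m -> 0 < z.2 < z.1 ->
  {for z, continuous (fun z : R * R => c_hat alpha s p0 z.1 z.2 mts m)}.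
Proof.
move=> m0 z0; have -> : (fun z : R * R => c_hat alpha s p0 z.1 z.2 mts m) =
    (fun z => pos_part (decoy_estimate (1 - s) (p0 / 2) (click alpha m)
      (click alpha mts) z.2 z.1)).
  by apply/funext => z'; rewrite c_hatE.
exact: continuous_decoy_estimate.
Qed.

Lemma continuous_b_hat m (z : R * R) : 0 < z.2 ->
  {for z, continuous (fun z : R * R => b_hat alpha s p0 z.2 m)}.
Proof.
move=> z0; have c2 : {for z, continuous (fun z : R * R => z.2)} by exact: cvg_snd.
apply: (@continuous_max _ _ _ (cst 0)); last exact: cvg_cst.
apply: cvgM; last by apply: cvgV => //; rewrite gt_eqF.
apply: cvgB; last exact: cvg_cst.
apply: cvgM; first exact: cvg_cst.
by apply: (continuous_comp c2); exact: continuous_expR.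
Qed.

(** * Common treatment of the two rates *)

(** The total [A] is [c_hat + b_hat] for [key_rate] and [a_hat] for [tkey_rate]. *)
Definition rate_of_total (A : R -> R -> R -> R -> R) (H : R -> R) (eta : R)
    (ms md mts' mtd : R) : R :=
  let a := A ms md mts' mtd in let b := b_hat alpha s p0 md mtd in
  ms * expR (- ms) * a * (1 - H (b / a)) + expR (- ms) * p0
  - det_rate alpha p0 mts' * eta * h (err_rate alpha s p0 mts').

Local Notation a0 := (beta + p0).
Local Notation b0 := (s * beta + p0 / 2).
Local Notation phi0 := (a0 * (1 - h_phase (b0 / a0))).

Lemma error_ratio0_lt_half : 0 <= b0 / a0 < 2^-1.
Proof.
have [[bg s0'] s2'] := (beta_gt0, s0, s2).
have a00 : 0 < a0 by rewrite ltr_pwDl.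
have sb : s * beta < 1 / 2 * beta by rewrite ltr_pM2r.
have sb0 : 0 <= s * beta by rewrite mulr_ge0// ltW.
rewrite divr_ge0 ?(ltW a00) ?addr_ge0 ?divr_ge0//=.
by rewrite ltr_pdivrMr//; lra.
Qed.

Lemma key_fraction0_gt0 : 0 < phi0.
Proof.
have /andP[q0 q2] := error_ratio0_lt_half.
apply: mulr_gt0; first by apply: ltr_pwDl; [exact: beta_gt0|exact: p00].
by rewrite subr_gt0 h_phaseE ?h_lt1// ltW.
Qed.

Lemma limit_rateE eta : limit_rate alpha s p0 eta eps mts =
  (1 - eps) * mts * expR (- ((1 - eps) * mts)) * phi0
  + expR (- ((1 - eps) * mts)) * p0
  - det_rate alpha p0 mts * eta * h (err_rate alpha s p0 mts).
Proof.
have /andP[_ q2] := error_ratio0_lt_half.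
rewrite /limit_rate /phase_err0 /photon_rate0 h_phaseE ?(ltW q2)//.
by congr (_ + _ - _); rewrite [RHS]mulrA.
Qed.

Hypothesis hmts : mts * (1 + eps) <=
  1 - p0 / (photon_rate0 alpha p0 eps * (1 - h (phase_err0 alpha s p0 eps))).

(** Multiplied by [phi0], the hypothesis on [mts] gives [ms * phi0 + p0 <= phi0] at every possible
    [ms], as [mul_expRN_le] demands. *)
Lemma single_photon_rate_le ms : true_intensities eps mts ms ->
  ((1 - eps) * mts * phi0 + p0) * expR (- ((1 - eps) * mts)) <=
  (ms * phi0 + p0) * expR (- ms).
Proof.
move=> /true_intensitiesP/andP[sl su].
have phi_gt0 := key_fraction0_gt0.
have x0 : 0 < (1 - eps) * mts by rewrite mulr_gt0// subr_gt0.
have := hmts; rewrite /phase_err0 /photon_rate0 -h_phaseE; last first.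
  by case/andP: error_ratio0_lt_half => _ /ltW.
move=> M.
have pk : 0 <= p0 / phi0 by rewrite divr_ge0// ltW.
have ms1 : ms <= 1 - p0 / phi0 by rewrite (le_trans su)// mulrC.
apply: mul_expRN_le => //.
- exact: ltW.
- exact: ltW.
- by move: pk ms1 x0; move: (p0 / _) (_ * mts) => *; lra.
- have := ler_wpM2r (ltW phi_gt0) ms1.
  by rewrite mulrBl mul1r divfK ?gt_eqF// lerBrDr.
Qed.

(** Since [H] agrees with [h_phase] at all ratios arising from [D], the whole argument runs with
    [h_phase], whose key fraction is continuous and monotone. *)
Lemma sup_is_limit_at0_rate (A : R -> R -> R -> R -> R) (H : R -> R) (D : set R) eta :
  (forall ms md m, 0 <= A ms md mts m) ->
  (forall m z, 0 < m -> 0 < z.2 < z.1 ->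
    {for z, continuous (fun z : R * R => A z.1 z.2 mts m)}) ->
  (forall m, decoys eps mts m ->
    A ((1 - eps) * mts) ((1 + eps) * m) mts m
      - b_hat alpha s p0 ((1 + eps) * m) m <= a0 - b0) ->
  (exists2 K, 0 <= K & exists2 m0, 0 < m0 &
    forall m ms md, 0 < m -> m < m0 ->
      true_intensities eps mts ms -> true_intensities eps m md ->
      exists u, [/\ beta - K * m <= u,
        b_hat alpha s p0 md m <= s * u + p0 / 2 + K * m &
        (1 - s) * u + p0 / 2 - K * m
          <= A ms md mts m - b_hat alpha s p0 md m]) ->
  D `<=` decoys eps mts ->
  (exists2 m1, 0 < m1 & forall m, 0 < m -> m < m1 -> D m) ->
  (forall m ms md, D m ->
     true_intensities eps mts ms -> true_intensities eps m md ->
     H (b_hat alpha s p0 md m / A ms md mts m)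
       = h_phase (b_hat alpha s p0 md m / A ms md mts m)) ->
  sup_is_limit_at0 D (rate_of_total A H eta) eps mts
    (limit_rate alpha s p0 eta eps mts).
Proof.
move=> A0 cA Acorner [K K0 [m0 m0_gt0 est]] DD [m1 m1_gt0 Dnear] HD.
have b_ge0 md m : 0 <= b_hat alpha s p0 md m by exact: pos_part_ge0.
have [[bg s0'] s2'] := (beta_gt0, s0, s2).
have b00 : 0 <= b0 by rewrite addr_ge0 ?divr_ge0// mulr_ge0// ltW.
have a00 : 0 <= a0 by rewrite addr_ge0// ltW.
have x0 : 0 < (1 - eps) * mts by rewrite mulr_gt0// subr_gt0.
have [K' K'0 low] := key_fraction_lower s0 s2 p00 bg.
have rateE m ms md : D m ->
    true_intensities eps mts ms -> true_intensities eps m md ->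
    rate_of_total A H eta ms md mts m = rate_of_total A (@h_phase R) eta ms md mts m.
  by move=> Dm tms tmd; rewrite /rate_of_total HD.
(* [key_fraction_lower] with [r = K * m] loses [K' * (K * m)], and the prefactor [ms * expR (- ms)]
   is at most 1. *)
apply: (@sup_is_limit_at0_linear _ _ _ _ _ _ (K' * K) (Num.min m0 m1)).
- exact: ltW.
- exact: ltW.
- exact: mulr_ge0.
- by rewrite lt_min m0_gt0.
- by move=> m /DD[].
- move=> m Dm; have dm := DD _ Dm; have [mp _ _] := dm.
  have rect0 : true_intensities eps mts `*` true_intensities eps m !=set0.
    exists ((1 - eps) * mts, (1 - eps) * m); split=> /=.
      by have [] := true_intensities_ends (ltW eps0) (ltW mts0).
    by have [] := true_intensities_ends (ltW eps0) (ltW mp).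
  have rectc : compact (true_intensities eps mts `*` true_intensities eps m).
    by apply: compact_setX; exact: segment_compact.
  have crate : {within true_intensities eps mts `*` true_intensities eps m,
      continuous (fun z : R * R => rate_of_total A (@h_phase R) eta z.1 z.2 mts m)}.
    apply: continuous_in_subspaceT => z; rewrite inE => -[tz1 tz2].
    have z0 := true_intensities_order dm tz1 tz2.
    have ce : {for z, continuous (fun z : R * R => expR (- z.1))}.
      apply: (@continuous_comp _ _ _ (fun z : R * R => - z.1) expR).
        by apply: cvgN; exact: cvg_fst.
      exact: continuous_expR.
    apply: cvgB; last exact: cvg_cst.
    apply: cvgD; last by apply: cvgM => //; exact: cvg_cst.
    (* Reassociation isolates the key fraction, which is continuous as a whole even where the ratio
       inside it is not. *)
    under eq_fun do rewrite -mulrA.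
    rewrite -mulrA.
    apply: cvgM; first by apply: cvgM => //; exact: cvg_fst.
    apply: (@continuous_key_fraction _ _ (fun z : R * R => A z.1 z.2 mts m)
      (fun z => b_hat alpha s p0 z.2 m)) => //.
      exact: cA.
    by apply: continuous_b_hat; case/andP: z0.
  have [z] := compact_EVT_min rect0 rectc crate.
  rewrite inE => zr zmin; exists z => // z' z'r.
  have [zr1 zr2] := zr; have [z'r1 z'r2] := z'r.
  by rewrite !rateE//; apply: zmin; rewrite inE.
- move=> m Dm; have dm := DD _ Dm; have [mp _ _] := dm.
  have [tx _] := true_intensities_ends (ltW eps0) (ltW mts0).
  have [_ ty] := true_intensities_ends (ltW eps0) (ltW mp).
  rewrite rateE// limit_rateE /rate_of_total lerD2r lerD2r -mulrA.
  apply: ler_wpM2l; first by rewrite mulr_ge0 ?expR_ge0// ltW.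
  by apply: key_fraction_mono => //; [exact: (b_hat_corner dm)|exact: Acorner].
- by move=> m mp; rewrite lt_min => /andP[_]; exact: Dnear.
- move=> m ms md mp; rewrite lt_min => /andP[mm0 mm1] tms tmd.
  have Dm := Dnear m mp mm1.
  have [u [ub bb ab]] := est m ms md mp mm0 tms tmd.
  have /andP[md0 mdms] := true_intensities_order (DD _ Dm) tms tmd.
  have ms0 : 0 < ms by exact: lt_trans mdms.
  have Km : 0 <= K * m by rewrite mulr_ge0// ltW.
  (* A vanishing limit error forces [p0 = 0] and [s = 0], so that [b_hat] is exactly 0. *)
  have b0b : b0 = 0 -> b_hat alpha s p0 md m = 0.
    have sb : 0 <= s * beta by rewrite mulr_ge0// ltW.
    move=> bE; have p0E : p0 = 0 by have p00' := p00; lra.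
    have /eqP : s * beta = 0 by move: bE; rewrite p0E; lra.
    rewrite mulf_eq0 (gt_eqF bg) orbF => /eqP sE.
    by rewrite b_hatE// /nonvacuum p0E sE !mul0r addr0 mulr0 subr0 mul0r.
  have := low _ _ _ _ (A0 ms md m) (b_ge0 md m) Km ub ab bb b0b.
  have := single_photon_rate_le tms.
  rewrite rateE// limit_rateE /rate_of_total -[ms * _ * _ * _]mulrA.
  move: (A ms md mts m * _) phi0 => X Y sp XY.
  have w0 : 0 <= ms * expR (- ms) by rewrite mulr_ge0 ?expR_ge0// ltW.
  have w1 : ms * expR (- ms) <= 1.
    rewrite expRN ler_pdivrMr ?expR_gt0// mul1r.
    by have := expR_ge1Dx ms; lra.
  have := ler_wpM2l w0 XY.
  have : ms * expR (- ms) * (K' * (K * m)) <= 1 * (K' * (K * m)).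
    by rewrite ler_wpM2r// mulr_ge0.
  move: sp; move: (expR _) (expR _) (_ * h _) w0 w1 => *.
  lra.
Qed.

(** Here [A - b] is just [c_hat], so the corner bound is the one for the weights [1 - s] and
    [p0 / 2]. *)
Lemma sup_is_limit_at0_key_rate (H : R -> R) (D : set R) eta :
  D `<=` decoys eps mts ->
  (exists2 m1, 0 < m1 & forall m, 0 < m -> m < m1 -> D m) ->
  (forall m ms md, D m ->
     true_intensities eps mts ms -> true_intensities eps m md ->
     let b := b_hat alpha s p0 md m in
     let c := c_hat alpha s p0 ms md mts m in
     H (b / (c + b)) = h_phase (b / (c + b))) ->
  sup_is_limit_at0 D (key_rate H alpha s p0 eta) eps mts
    (limit_rate alpha s p0 eta eps mts).
Proof.
move=> DD Dnear HD.
apply: (@sup_is_limit_at0_rate (fun ms md mts' mtd =>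
  c_hat alpha s p0 ms md mts' mtd + b_hat alpha s p0 md mtd)) => //.
- by move=> ms md m; rewrite addr_ge0// pos_part_ge0.
- move=> m z mp z0; apply: cvgD; first exact: continuous_c_hat.
  by apply: continuous_b_hat; case/andP: z0.
- move=> m dm; have [[mp _ _] s2'] := (dm, s2).
  have := decoy_estimate_corner dm.
  rewrite addrK c_hatE// => /(_ (1 - s) (p0 / 2)).
  rewrite divr_ge0// => /(_ _ isT)/le_trans; apply; first by lra.
  by move: beta => be; lra.
- have [K K0 [m0 m0_gt0 est]] := estimates_near0.
  exists K => //; exists m0 => // m ms md mp mm0 tms tmd.
  have [_ [u [ub bb cb _]]] := est m ms md mp mm0 tms tmd.
  by exists u; rewrite addrK.
Qed.

(** At the corner [a_hat] is at most its limit and [b_hat] at least its own, which bounds their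
    difference. *)
Lemma sup_is_limit_at0_tkey_rate (H : R -> R) (D : set R) eta :
  D `<=` decoys eps mts ->
  (exists2 m1, 0 < m1 & forall m, 0 < m -> m < m1 -> D m) ->
  (forall m ms md, D m ->
     true_intensities eps mts ms -> true_intensities eps m md ->
     let b := b_hat alpha s p0 md m in
     let a := a_hat alpha p0 ms md mts m in
     H (b / a) = h_phase (b / a)) ->
  sup_is_limit_at0 D (tkey_rate H alpha s p0 eta) eps mts
    (limit_rate alpha s p0 eta eps mts).
Proof.
move=> DD Dnear HD.
apply: (@sup_is_limit_at0_rate (fun ms md mts' mtd =>
  a_hat alpha p0 ms md mts' mtd)) => //.
- by move=> ms md m; exact: pos_part_ge0.
- by move=> m z _ z0; exact: continuous_a_hat.
- move=> m dm; rewrite lerB ?(b_hat_corner dm)// a_hatE.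
  by have := decoy_estimate_corner dm ler01 p00; rewrite mul1r.
- have [K K0 [m0 m0_gt0 est]] := estimates_near0.
  exists K => //; exists m0 => // m ms md mp mm0 tms tmd.
  have [_ [u [ub bb _ ab]]] := est m ms md mp mm0 tms tmd.
  by exists u.
Qed.

Lemma h_phase_half_ratio (a b : R) : 0 <= a -> b <= a / 2 -> h (b / a) = h_phase (b / a).
Proof.
rewrite le_eqVlt => /predU1P[<- _|a0 ba].
  (* Division by 0 gives 0, so both entropies are taken at 0. *)
  by rewrite invr0 mulr0 h_phaseE ?invr_ge0.
by rewrite h_phaseE// ler_pdivrMr// mulrC.
Qed.

End Rates.

Theorem theorem4 (R : realType) (alpha s p0 eta eps mts : R)
  (halpha0 : 0 < alpha) (halpha1 : alpha <= 1)
  (hs0 : 0 <= s) (hs1 : s < 1 / 2)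
  (hp0 : 0 <= p0)
  (heps0 : 0 < eps) (heps1 : eps < 1)
  (hmts0 : 0 < mts)
  (hmts : mts * (1 + eps) <=
     1 - p0 / (photon_rate0 alpha p0 eps *
               (1 - h (phase_err0 alpha s p0 eps)))) :
  let L := limit_rate alpha s p0 eta eps mts in
  (sup_is_limit_at0 (decoys_key_rate alpha s p0 eps mts)
     (key_rate (@h R) alpha s p0 eta) eps mts L /\
   sup_is_limit_at0 (decoys_tkey_rate alpha s p0 eps mts)
     (tkey_rate (@h R) alpha s p0 eta) eps mts L) /\
  (sup_is_limit_at0 (decoys eps mts)
     (key_rate (@h_phase R) alpha s p0 eta) eps mts L /\
   sup_is_limit_at0 (decoys eps mts)
     (tkey_rate (@h_phase R) alpha s p0 eta) eps mts L).
Proof.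
have [m1 m1_gt0 near0] :=
  error_ratio_near0 halpha0 hs0 hs1 hp0 heps0 heps1 hmts0.
have decoy_near0 m : 0 < m -> m < m1 -> decoys eps mts m.
  move=> mp mm1; have [tms _] := true_intensities_ends (ltW heps0) (ltW hmts0).
  have [tmd _] := true_intensities_ends (ltW heps0) (ltW mp).
  by have [] := near0 _ _ _ mp mm1 tms tmd.
(* The first two claims restrict the ratio to at most 1/2, where [h] and [h_phase] agree, and
   [near0] shows that all small decoy intensities remain. In the last two, the entropy is [h_phase]
   itself. *)
split; split.
- apply: sup_is_limit_at0_key_rate => //; first by move=> m [].
    exists m1 => // m mp mm1; split; first exact: decoy_near0.
    by move=> ms md tms tmd; have [] := near0 _ _ _ mp mm1 tms tmd.
  move=> m ms md [_ half] tms tmd; apply: h_phase_half_ratio; last exact: half.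
  by rewrite addr_ge0// pos_part_ge0.
- apply: sup_is_limit_at0_tkey_rate => //; first by move=> m [].
    exists m1 => // m mp mm1; split; first exact: decoy_near0.
    by move=> ms md tms tmd; have [] := near0 _ _ _ mp mm1 tms tmd.
  move=> m ms md [_ half] tms tmd; apply: h_phase_half_ratio; last exact: half.
  exact: pos_part_ge0.
- by apply: sup_is_limit_at0_key_rate => //; exists m1.
- by apply: sup_is_limit_at0_tkey_rate => //; exists m1.
Qed.
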